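(* Let $\alpha\in(0,1)$ be irrational and $f(x)=\frac1x$. There exists a sequence $d_N>0$ such that $$\lambda\left(\left|\frac{S_N(f)}{d_N}-1\right|>\epsilon\right)\to0\quad\text{as }N\to\infty,\qquad\forall\epsilon>0,$$ if and only if $\alpha$ is of Roth type. Furthermore, in this situation the convergence holds with $d_N=N\log(N)$ (for $N\ge2$).
   Context: $R(x)=x+\alpha \pmod 1$ on $[0,1)$, $\lambda$ is Lebesgue measure on $[0,1)$, and $S_N(f)(x)=\sum_{n=0}^{N-1}f(R^nx)$ (with the convention $f(0)=0$). Write $\alpha=[a_1,a_2,\dots]=\cfrac{1}{a_1+\cfrac{1}{a_2+\cdots}}$ for the continued fraction expansion. The denominators of the convergents are indexed by $q_0=0$, $q_1=1$ and $q_{n+1}=a_nq_n+q_{n-1}$ for $n\ge1$ (so $p_n/q_n=[a_1,\dots,a_{n-1}]$). The number $\alpha$ is of Roth type if for every $\epsilon>0$ one has $q_{n+1}<q_n^{1+\epsilon}$ for all large enough $n$; equivalently $\lim_{n\to\infty}\frac{\log q_{n+1}}{\log q_n}=1$. *)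

(* Defs.v *)
From HB Require Import structures.
From mathcomp Require Import all_boot all_order all_algebra.
From mathcomp Require Import all_classical all_reals all_analysis.
Set Implicit Arguments.
Unset Strict Implicit.
Unset Printing Implicit Defensive.
Import Order.TTheory GRing.Theory Num.Theory.
Import numFieldNormedType.Exports.
Local Open Scope classical_set_scope.
Local Open Scope ring_scope.

Definition frac_part (R : realType) (x : R) : R := x - (Num.floor x)%:~R.

Definition rotation (R : realType) (alpha x : R) : R := frac_part (x + alpha).

Definition birkhoff_sum (R : realType) (alpha : R) (f : R -> R) (N : nat)
    (x : R) : R :=
  \sum_(0 <= n < N) f (iter n (rotation alpha) x).

(** The convention [f 0 = 0] holds because [0^-1 = 0] in a [unitRingType]. *)
Definition recip (R : realType) (x : R) : R := x^-1.

Definition gauss_map (R : realType) (x : R) : R := frac_part x^-1.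

(** The partial quotients of an irrational [alpha] in (0,1) are
    [a_n = floor (1 / G^(n-1) alpha)] for [1 <= n], where [G] is the Gauss map;
    the value at [n = 0] is meaningless. *)
Definition partial_quotient (R : realType) (alpha : R) (n : nat) : nat :=
  Num.truncn (iter n.-1 (@gauss_map R) alpha)^-1.

(** Shifted indexing: [q_0 = 0], [q_1 = 1], [q_(n+1) = a_n q_n + q_(n-1)]. *)
Fixpoint cf_denom (R : realType) (alpha : R) (n : nat) : nat :=
  match n with
  | 0 => 0
  | m.+1 => match m with
            | 0 => 1
            | k.+1 => partial_quotient alpha m * cf_denom alpha m
                      + cf_denom alpha k
            end
  end%N.

Definition roth_type (R : realType) (alpha : R) : Prop :=
  forall eps : R, 0 < eps ->
    \forall n \near \oo,
      (cf_denom alpha n.+1)%:R < (cf_denom alpha n)%:R `^ (1 + eps).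

Definition weak_law (R : realType) (alpha : R) (f : R -> R) (d : nat -> R)
    : Prop :=
  forall eps : R, 0 < eps ->
    lebesgue_measure
      [set x : R | (x \in `[0, 1[) /\
                   (eps < `|birkhoff_sum alpha f N x / d N - 1|)]
    @[N --> \oo] --> 0%E.

(* Main.v *)
Require Import Defs.
From mathcomp Require Import all_boot all_order all_algebra.
From mathcomp Require Import all_classical all_reals all_analysis.
From mathcomp Require Import measurable_realfun.
From mathcomp Require Import ring lra zify.
Import Order.TTheory GRing.Theory Num.Theory.
Import numFieldNormedType.Exports.
Local Open Scope classical_set_scope.
Local Open Scope ring_scope.
Set Implicit Arguments.
Unset Strict Implicit.
Unset Printing Implicit Defensive.

(** Write [S_N] for the Birkhoff sum of [1/x], and let [p/q] be a convergent
    of [alpha], so that [eta = |q alpha - p|] is at most the inverse of the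
    next denominator. During [q] steps the rotation stays within [1/q] of
    the rotation by [p/q], so that [q] consecutive points of an orbit are
    spread like the grid of step [1/q] ([block_location]). Apart from the
    few points next to [0], the sum of [1/x] over such a block is a harmonic
    sum, equal to [q ln q + O(q)] uniformly in the starting point
    ([sum_block_le], [sum_block_ge]).

    If [alpha] is of Roth type, every large [N] admits a denominator [q]
    with [q = o(N)] but [ln q] asymptotic to [ln N] ([roth_approximation]).
    Cutting the orbit of length [N] into blocks of length [q] shows that
    [S_N] is at least [N ln N (1 - o(1))] everywhere, and that the points
    above [1/q] contribute at most [N ln N (1 + o(1))]. Points below
    [delta/N] occur only on a set of measure [O(delta)]. Those between
    [delta/N] and [1/q] contribute in mean [N] times the integral of [1/x]
    over that range, that is [N ln (N/(delta q)) = o(N ln N)], and Markov's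
    inequality concludes ([visits_markov], [roth_weak_law]).

    If [alpha] is not of Roth type, there are [e > 0] and arbitrarily large
    [q] with [eta <= q^(- 1 - e)]. Take [N] a multiple of [q] of order
    [c/eta], with [c] small. Until time [N] the orbit drifts away from the
    grid of step [1/q] by at most [c/q], so that it consists of [q]
    clusters, arithmetic progressions of step [eta]. With positive
    probability [0] is at distance of order [1/q] from every cluster, and
    then [S_N] is [O((c/eta) ln q)] ([birkhoff_sum_le_mid]). With positive
    probability a cluster crosses [0], and then this cluster alone
    contributes at least [1/eta] times the logarithm of its size, which is
    of order [(e/eta) ln q] ([crossing_interval]). For [c] small compared to
    [e] these two values are too far apart for any normalisation
    ([weak_law_roth]). *)

(** * The rotation as a shift of lifts to the line *)

Section FractionalPart.
Context {R : realType}.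
Implicit Types x t alpha : R.

Lemma frac_part_bounds x : 0 <= frac_part x < 1.
Proof.
have := floor_itv x; rewrite /frac_part intrD.
set n := (Num.floor x)%:~R; lra.
Qed.

Lemma frac_partDz x (m : int) : frac_part (x + m%:~R) = frac_part x.
Proof.
rewrite /frac_part floorDrz ?intr_int// intrKfloor intrD; lra.
Qed.

Lemma frac_part_id x : 0 <= x < 1 -> frac_part x = x.
Proof.
by move=> x01; rewrite /frac_part (@floor_def _ _ 0) ?subr0.
Qed.

Lemma frac_part_eq x t (m : int) :
  0 <= t < 1 -> x = t + m%:~R -> frac_part x = t.
Proof. by move=> t01 ->; rewrite frac_partDz frac_part_id. Qed.

Lemma frac_partE x : exists m : int, x = frac_part x + m%:~R.
Proof. by exists (Num.floor x); rewrite /frac_part subrK. Qed.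

Lemma iter_rotation alpha x n : 0 <= x < 1 ->
  iter n (rotation alpha) x = frac_part (x + n%:R * alpha).
Proof.
move=> x01; elim: n => [|n IH]; first by rewrite mul0r addr0 frac_part_id.
rewrite iterS IH /rotation.
have [m mE] := frac_partE (x + n%:R * alpha).
set y := frac_part _ in mE *.
have -> : x + n.+1%:R * alpha = (y + alpha) + m%:~R.
  by rewrite -natr1 mulrDl mul1r addrA mE addrAC.
by rewrite frac_partDz.
Qed.

Lemma birkhoff_sumE alpha (f : R -> R) N x : 0 <= x < 1 ->
  birkhoff_sum alpha f N x =
  \sum_(0 <= k < N) f (frac_part (x + k%:R * alpha)).
Proof. by move=> x01; apply: eq_bigr => k _; rewrite iter_rotation. Qed.

End FractionalPart.

(** * Harmonic sums *)

Section Harmonic.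
Context {R : realType}.

Lemma ln_le_harmonic m :
  ln m.+1%:R <= \sum_(0 <= j < m) (j.+1%:R)^-1 :> R.
Proof.
elim: m => [|m IH]; first by rewrite ln1 big_geq.
rewrite big_nat_recr//=.
have -> : m.+2%:R = m.+1%:R * (1 + m.+1%:R^-1) :> R.
  by rewrite mulrDr mulr1 divff// natr1.
have m1 : 0 < m.+1%:R^-1 :> R by rewrite invr_gt0 ltr0n.
rewrite lnM ?posrE ?ltr0n ?addr_gt0//.
by rewrite lerD// le_ln1Dx// (lt_trans _ m1)// ltrN10.
Qed.

Lemma harmonic_le_ln m :
  \sum_(0 <= j < m.+1) (j.+1%:R)^-1 <= 1 + ln m.+1%:R :> R.
Proof.
elim: m => [|m IH]; first by rewrite big_nat1 ln1 invr1 addr0.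
rewrite big_nat_recr//=.
have m2 : 0 < m.+2%:R :> R by rewrite ltr0n.
have m1 : 0 < m.+1%:R :> R by rewrite ltr0n.
have mE : m.+2%:R = m.+1%:R + 1 :> R by rewrite natr1.
suff : ln m.+1%:R <= ln m.+2%:R - m.+2%:R^-1 :> R.
  rewrite lerBrDr => h; apply: le_trans (lerD IH (lexx _)) _.
  by rewrite -addrA lerD2l.
have -> : m.+1%:R = m.+2%:R * (1 + (- m.+2%:R^-1)) :> R.
  by rewrite mulrDr mulr1 mulrN divff ?gt_eqF// mE addrK.
have i1 : m.+2%:R^-1 < 1 :> R by rewrite invf_lt1// mE ltrDr.
have i0 : 0 < m.+2%:R^-1 :> R by rewrite invr_gt0.
rewrite lnM ?posrE ?subr_gt0//.
by rewrite lerD2l le_ln1Dx// ltrN2.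
Qed.

End Harmonic.

(** * Progressions modulo [q] *)

Lemma modn_progression_inj (p q i k l : nat) : coprime p q ->
  (k < q)%N -> (l < q)%N ->
  ((i + k * p) %% q)%N = ((i + l * p) %% q)%N -> k = l.
Proof.
move=> cpq; wlog kl : k l / (k <= l)%N.
  move=> H kq lq e; case/orP: (leq_total k l) => h; first exact: H.
  by apply/esym; apply: H.
move=> kq lq /eqP; rewrite eqn_modDl => /eqP e.
have : (q %| l * p - k * p)%N by rewrite -eqn_mod_dvd ?leq_mul2r ?kl ?orbT// e.
rewrite -mulnBl Gauss_dvdl; last by rewrite coprime_sym.
move=> /dvdn_leq; case: (posnP (l - k)%N) => h; first by lia.
by move=> /(_ isT); lia.
Qed.

(** Injectivity on the finite type of residues is what makes the progression run
    exactly once through all of them; this is the coprimality of [p] and [q]. *)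
Lemma modn_progression_bij (p q i : nat) : coprime p q.+1 ->
  exists2 h : 'I_q.+1 -> 'I_q.+1, injective h &
    forall k, h k = ((i + k * p) %% q.+1)%N :> nat.
Proof.
move=> cpq; pose h (k : 'I_q.+1) : 'I_q.+1 := inord ((i + k * p) %% q.+1).
have hE k : h k = ((i + k * p) %% q.+1)%N :> nat by rewrite inordK// ltn_mod.
exists h => // k l /(congr1 val) /=; rewrite !hE => e; apply: ord_inj.
exact: (modn_progression_inj cpq (ltn_ord k) (ltn_ord l) e).
Qed.

Lemma sum_modn_progression (V : nmodType) (F : nat -> V) (p q i : nat) :
  coprime p q ->
  \sum_(0 <= k < q) F ((i + k * p) %% q)%N = \sum_(0 <= j < q) F j.
Proof.
case: q => [|q] cpq; first by rewrite !big_geq.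
have [h inj hE] := modn_progression_bij i cpq.
rewrite !big_mkord [RHS](reindex_inj inj)/=.
by apply: eq_bigr => k _; rewrite hE.
Qed.

Lemma modn_progression_onto (p q i j : nat) : coprime p q -> (j < q)%N ->
  exists2 k, (k < q)%N & ((i + k * p) %% q)%N = j.
Proof.
case: q => // q cpq jq; have [h inj hE] := modn_progression_bij i cpq.
by exists (invF inj (Ordinal jq)) => //; rewrite -hE f_invF.
Qed.

(** * Continued fractions *)

Section ContinuedFraction.
Context {R : realType}.
Variable alpha : R.
Hypotheses (alpha_gt0 : 0 < alpha) (alpha_lt1 : alpha < 1).
Hypothesis alpha_irr : irrational alpha.

Let x_ n := iter n (@gauss_map R) alpha.

Lemma irrationalV (x : R) : irrational x -> irrational x^-1.
Proof.
by move=> ix [r _ rE]; apply: ix; exists r^-1 => //; rewrite fmorphV/= rE invrK.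
Qed.

Lemma irrational_frac_part (x : R) : irrational x -> irrational (frac_part x).
Proof.
move=> ix [r _ rE]; apply: ix; exists (r + (Num.floor x)%:~R) => //.
by rewrite raddfD/= ratr_int rE /frac_part subrK.
Qed.

Lemma irrational_neq0 (x : R) : irrational x -> x != 0.
Proof.
by move=> ix; apply/eqP => x0; apply: ix; exists 0; rewrite // rmorph0 x0.
Qed.

Lemma gauss_orbit_irr n : irrational (x_ n).
Proof.
elim: n => // n IH; rewrite /x_ iterS.
exact/irrational_frac_part/irrationalV.
Qed.

Lemma gauss_orbit_bounds n : 0 < x_ n < 1.
Proof.
case: n => [|n]; first by rewrite /x_/= alpha_gt0.
rewrite lt_neqAle eq_sym irrational_neq0 ?frac_part_bounds//.
exact: gauss_orbit_irr.
Qed.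

Lemma partial_quotientE n :
  (x_ n)^-1 = (partial_quotient alpha n.+1)%:R + x_ n.+1.
Proof.
have /andP[x0 _] := gauss_orbit_bounds n.
have v0 : 0 <= (x_ n)^-1 by rewrite invr_ge0 ltW.
rewrite /partial_quotient [x_ n.+1]/(frac_part (x_ n)^-1).
rewrite /frac_part /= -/(x_ n).
rewrite -[Num.floor _]gez0_abs ?floor_ge0// truncn_floor v0.
by rewrite pmulrn addrC subrK.
Qed.

Lemma partial_quotient_gt0 n : (0 < partial_quotient alpha n.+1)%N.
Proof.
rewrite /partial_quotient/= truncn_gt0 -/(x_ n).
by have /andP[? ?] := gauss_orbit_bounds n; rewrite invf_ge1// ltW.
Qed.

(** Indexed like [cf_denom], so that the convergents are the quotients
    [cf_num n / cf_denom n]. *)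
Fixpoint cf_num n : nat :=
  match n with
  | 0 => 1
  | m.+1 => match m with
            | 0 => 0
            | k.+1 => partial_quotient alpha m * cf_num m + cf_num k
            end
  end%N.

Local Notation q_ := (cf_denom alpha).
Local Notation p_ := cf_num.

Lemma cf_denomSS n : q_ n.+2 = (partial_quotient alpha n.+1 * q_ n.+1 + q_ n)%N.
Proof. by []. Qed.

Lemma cf_numSS n : p_ n.+2 = (partial_quotient alpha n.+1 * p_ n.+1 + p_ n)%N.
Proof. by []. Qed.

Lemma cf_denom_leS n : (q_ n <= q_ n.+1)%N.
Proof.
case: n => // n; rewrite cf_denomSS.
by apply: leq_trans (leq_addr _ _); rewrite leq_pmull// partial_quotient_gt0.
Qed.

Lemma cf_denom_mono m n : (m <= n)%N -> (q_ m <= q_ n)%N.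
Proof. exact: (homo_leq leqnn leq_trans cf_denom_leS). Qed.

Lemma cf_denom_gt0 n : (0 < q_ n.+1)%N.
Proof. exact: (@cf_denom_mono 1). Qed.

Lemma cf_denom_ge n : (n <= q_ n.+1)%N.
Proof.
elim: n => // -[|n] IH; first exact: cf_denom_gt0.
rewrite cf_denomSS.
have := partial_quotient_gt0 n.+1; have := cf_denom_gt0 n; nia.
Qed.

(** The distance from [q_n alpha] to [p_n], see [gapE]. *)
Let gap n : R := \prod_(0 <= i < n) x_ i.

Lemma gap_gt0 n : 0 < gap n.
Proof. by apply: prodr_gt0 => i _; have /andP[] := gauss_orbit_bounds i. Qed.

Lemma gapSS n : gap n.+2 = gap n - (partial_quotient alpha n.+1)%:R * gap n.+1.
Proof.
have /andP[x0 _] := gauss_orbit_bounds n.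
have aE : (partial_quotient alpha n.+1)%:R * x_ n = 1 - x_ n.+1 * x_ n.
  rewrite -[X in X * _](addrK (x_ n.+1)) -partial_quotientE mulrBl.
  by rewrite mulVf ?gt_eqF.
have gS m : gap m.+1 = gap m * x_ m by rewrite /gap big_nat_recr.
rewrite !gS; clear x0; move: (gap n) (x_ n) (x_ n.+1) aE => g y z aE.
by rewrite [X in _ = _ - X]mulrCA aE; ring.
Qed.

Lemma gapE n : (q_ n)%:R * alpha - (p_ n)%:R = (-1) ^+ n.+1 * gap n.
Proof.
suff : (q_ n)%:R * alpha - (p_ n)%:R = (-1) ^+ n.+1 * gap n /\
  (q_ n.+1)%:R * alpha - (p_ n.+1)%:R = (-1) ^+ n.+2 * gap n.+1 by case.
elim: n => [|n [IH1 IH2]].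
  by rewrite /gap big_geq// big_nat1 /x_/=; split; ring.
split => //; rewrite cf_denomSS cf_numSS gapSS !natrD !natrM.
set a := (partial_quotient _ _)%:R.
rewrite [LHS](_ : _ = a * ((q_ n.+1)%:R * alpha - (p_ n.+1)%:R)
   + ((q_ n)%:R * alpha - (p_ n)%:R)); last by ring.
by rewrite IH1 IH2 !exprS; ring.
Qed.

(** The determinant identity between consecutive convergents, written with their
    gaps; it bounds [gap n.+1] by the inverse of the denominator [q_ n.+2]. *)
Lemma denom_gap n : (q_ n.+1)%:R * gap n + (q_ n)%:R * gap n.+1 = 1.
Proof.
elim: n => [|n IH]; first by rewrite /gap big_geq//= mul0r addr0 mulr1.
rewrite -[RHS]IH gapSS cf_denomSS natrD natrM; ring.
Qed.

Lemma cf_coprime n : coprime (p_ n) (q_ n).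
Proof.
suff h : forall d, (d %| p_ n)%N -> (d %| q_ n)%N -> (d %| 1)%N.
  by rewrite /coprime -dvdn1 h// ?dvdn_gcdl ?dvdn_gcdr.
(* the determinant identity in nat, its sign alternating with [n] *)
suff : (q_ n.+1 * p_ n = q_ n * p_ n.+1 + 1 \/
        q_ n * p_ n.+1 = q_ n.+1 * p_ n + 1)%N.
  case=> e d dp dq.
    by rewrite -(@dvdn_addr (q_ n * p_ n.+1)) ?dvdn_mulr// -e dvdn_mull.
  by rewrite -(@dvdn_addr (q_ n.+1 * p_ n)) ?dvdn_mull// -e dvdn_mulr.
elim: n => [|n IH]; first by left.
rewrite cf_denomSS cf_numSS; case: IH => IH; [right|left]; nia.
Qed.

Lemma convergent_approx n : exists p : nat,
  [/\ coprime p (q_ n.+1), 0 < `|(q_ n.+1)%:R * alpha - p%:R| &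
      `|(q_ n.+1)%:R * alpha - p%:R| <= (q_ n.+2)%:R^-1].
Proof.
exists (p_ n.+1); rewrite cf_coprime gapE normrM normrX normrN1 expr1n mul1r.
rewrite gtr0_norm ?gap_gt0//; split => //.
have q0 : 0 < (q_ n.+2)%:R :> R by rewrite ltr0n cf_denom_gt0.
rewrite -[leRHS]mul1r ler_pdivlMr// -[leRHS](denom_gap n.+1) mulrC lerDl.
by rewrite mulr_ge0// ltW// gap_gt0.
Qed.

End ContinuedFraction.

(** * Sums over blocks of [q] consecutive points *)

Section Blocks.
Context {R : realType}.
Variable alpha : R.
Implicit Types (x s M K : R) (g : R -> R) (p q i j k : nat).

Definition rot_orbit x k : R := frac_part (x + k%:R * alpha).

Lemma rot_orbit_bounds x k : 0 <= rot_orbit x k < 1.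
Proof. exact: frac_part_bounds. Qed.

Lemma rot_orbitD x k l : rot_orbit x (k + l) = rot_orbit (rot_orbit x k) l.
Proof.
rewrite /rot_orbit; have [m mE] := frac_partE (x + k%:R * alpha).
set y := frac_part _ in mE *.
have -> : x + (k + l)%:R * alpha = (y + l%:R * alpha) + m%:~R.
  by rewrite natrD mulrDl addrA mE addrAC.
by rewrite frac_partDz.
Qed.

Lemma rot_orbit_lift p q i k s : (0 < q)%N ->
  rot_orbit (i%:R / q%:R + s) k =
  frac_part (((i + k * p) %% q)%N%:R / q%:R +
             (s + k%:R * (alpha - p%:R / q%:R))).
Proof.
move=> q0; rewrite /rot_orbit.
rewrite -[RHS](frac_partDz _ ((i + k * p) %/ q)%N); congr frac_part.
have qn0 : q%:R != 0 :> R by rewrite pnatr_eq0 -lt0n.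
have e : i%:R + k%:R * p%:R =
    ((i + k * p) %/ q)%N%:R * q%:R + ((i + k * p) %% q)%N%:R :> R.
  by rewrite -!natrM -!natrD -divn_eq.
rewrite -pmulrn; move: e.
set u := (_ %/ _)%N%:R; set v := (_ %% _)%N%:R => e.
have -> : v = i%:R + k%:R * p%:R - u * q%:R by rewrite e addrC addKr.
by field.
Qed.

Lemma grid_point_bounds q i (v : R) : (i < q)%N -> 0 <= v < 1 ->
  0 <= i%:R / q%:R + v / q%:R < 1.
Proof.
move=> iq /andP[v0 v1].
have qp : 0 < q%:R :> R by rewrite ltr0n (leq_ltn_trans _ iq).
have iq' : i%:R + 1 <= q%:R :> R by rewrite natr1 ler_nat.
have i0 : 0 <= i%:R :> R by [].
rewrite -mulrDl ler_pdivlMr// ltr_pdivrMr// mul0r mul1r.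
by apply/andP; split; lra.
Qed.

Lemma grid_decomposition x q : (0 < q)%N -> 0 <= x ->
  exists i s, x = i%:R / q%:R + s /\ 0 <= s < q%:R^-1.
Proof.
move=> q0 x0; have qp : 0 < q%:R :> R by rewrite ltr0n.
have /truncn_itv /andP[h1 h2] : 0 <= x * q%:R by rewrite mulr_ge0 ?ler0n.
set i := Num.truncn _ in h1 h2; exists i, (x - i%:R / q%:R).
split; first by lra.
rewrite subr_ge0 ler_pdivrMr// h1/=.
rewrite ltrBlDr -[X in X + _]mul1r -mulrDl ltr_pdivlMr//.
by rewrite addrC natr1.
Qed.

(** A block of [q] consecutive orbit points looks like the grid of step [1/q],
    because over so short a time the rotation differs from the one by [p/q] by
    less than [1/q]. The cells [0] and [q - 1] are excluded because a point may
    leave them through the discontinuity at [0]. *)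
Lemma block_location x p q : (0 < q)%N -> 0 <= x ->
  `|q%:R * alpha - p%:R| <= q%:R^-1 ->
  exists i, forall k, (k < q)%N -> forall j, ((i + k * p) %% q)%N = j ->
    (0 < j)%N -> (j.+1 < q)%N ->
    (j.-1%:R / q%:R < rot_orbit x k) && (rot_orbit x k < (j + 2)%:R / q%:R).
Proof.
move=> q0 x0 app; have [i [s [xE /andP[s0 s1]]]] := grid_decomposition q0 x0.
have qp : 0 < q%:R :> R by rewrite ltr0n.
exists i => k kq j jE j0 jq.
set theta := alpha - p%:R / q%:R.
have kth : `|k%:R * theta| < q%:R^-1.
  have -> : theta = (q%:R * alpha - p%:R) / q%:R by rewrite /theta; field; lra.
  rewrite !normrM normfV [`|k%:R|]ger0_norm// [`|q%:R|]gtr0_norm//.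
  rewrite mulrCA mulrC; apply: le_lt_trans (ler_wpM2l _ app) _.
    by rewrite divr_ge0.
  rewrite mulrC gtr_pMr ?invr_gt0// ltr_pdivrMr// mul1r ltr_nat//.
move: kth; rewrite ltr_norml => /andP[th1 th2].
have j2 : (j.+2)%:R / q%:R <= 1 :> R by rewrite ler_pdivrMr// mul1r ler_nat.
have jm : j%:R = j.-1%:R + 1 :> R by rewrite natr1 prednK.
have v0 : 0 < q%:R^-1 :> R by rewrite invr_gt0.
have jm0 : 0 <= j.-1%:R / q%:R :> R by rewrite divr_ge0.
have j2E : (j + 2)%:R / q%:R =
    j.-1%:R / q%:R + q%:R^-1 + q%:R^-1 + q%:R^-1 :> R.
  by rewrite natrD jm; ring.
have jE' : j%:R / q%:R = j.-1%:R / q%:R + q%:R^-1 :> R.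
  by rewrite jm mulrDl mul1r.
rewrite -addn2 j2E in j2.
rewrite xE (@rot_orbit_lift p)// jE -/theta jE' j2E frac_part_id;
  by apply/andP; split; lra.
Qed.

(** By [block_location] the points of a block lie, up to a shift by one cell,
    one in each cell, so that the block sum is a harmonic sum; the cap [M] on
    [g] is used for the three points that may be very close to [0]. *)
Lemma sum_block_le g p q x M : coprime p q -> 0 <= x -> 0 <= M ->
  `|q%:R * alpha - p%:R| <= q%:R^-1 ->
  (forall y, 0 <= y < 1 -> g y <= M) ->
  (forall y, 0 < y < 1 -> g y <= y^-1) ->
  \sum_(0 <= k < q) g (rot_orbit x k) <= 3 * M + q%:R * (1 + ln q%:R).
Proof.
move=> cpq x0 M0 app gM gV.
have [->|q0] := posnP q; first by rewrite big_geq// mul0r addr0 mulr_ge0.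
have qp : 0 < q%:R :> R by rewrite ltr0n.
have [i loc] := block_location q0 x0 app.
(* the bound for the point of cell [j] *)
pose h j : R := if (1 < j)%N && (j.+1 < q)%N then q%:R * j.-1%:R^-1 else M.
have lnq : 0 <= ln q%:R :> R by rewrite ln_ge0// ler1n.
apply: (@le_trans _ _ (\sum_(0 <= j < q) h j)).
  rewrite -(sum_modn_progression h i cpq); apply: ler_sum_nat => k /andP[_ kq].
  rewrite /h; case: ifP => [/andP[j1 j2]|_]; last exact/gM/rot_orbit_bounds.
  have /andP[l1 _] := loc k kq _ erefl (ltnW j1) j2.
  set j := (_ %% _)%N in j1 j2 l1 *.
  have jp : 0 < j.-1%:R :> R by rewrite ltr0n; lia.
  have y0 : 0 < rot_orbit x k by apply: lt_trans l1; rewrite divr_gt0.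
  apply: le_trans (gV _ _) _.
    by case/andP: (rot_orbit_bounds x k) => _ ->; rewrite y0.
  rewrite -[_ * _]invrK invfM invrK lef_pV2 ?posrE//.
    by rewrite mulrC ltW.
  by rewrite mulr_gt0 ?invr_gt0.
case: q {cpq app loc} @h q0 qp lnq => // -[|[|q]] h _ qp lnq.
- by rewrite big_nat1/= /h/= ln1; lra.
- by rewrite !big_nat_recr//= big_geq//= /h/=; lra.
rewrite big_nat_recr//= big_nat_recl//= big_nat_recl//=.
rewrite [h 0]/h [h 1]/h [h q.+2]/h/= ltnn.
have -> : \sum_(0 <= j < q) h j.+2 =
    q.+3%:R * \sum_(0 <= j < q) (j.+1%:R)^-1.
  rewrite mulr_sumr; apply: eq_big_nat => j /andP[_ jq].
  by rewrite /h/= !ltnS jq.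
suff : \sum_(0 <= j < q) (j.+1%:R)^-1 <= 1 + ln q.+3%:R :> R.
  move=> /(ler_wpM2l (ltW qp)); lra.
case: q {h qp} lnq => [|q] lnq; first by rewrite big_geq//; lra.
apply: le_trans (harmonic_le_ln _) _.
by rewrite lerD2l ler_ln ?posrE ?ltr0n// ler_nat; lia.
Qed.

Lemma sum_block_ge p q x : coprime p q -> 0 <= x ->
  `|q%:R * alpha - p%:R| <= q%:R^-1 ->
  q%:R * (ln q%:R - 2) <= \sum_(0 <= k < q) (rot_orbit x k)^-1.
Proof.
move=> cpq x0 app.
have [->|q0] := posnP q; first by rewrite big_geq// mul0r.
have qp : 0 < q%:R :> R by rewrite ltr0n.
have [i loc] := block_location q0 x0 app.
pose h j : R := if (0 < j)%N && (j.+1 < q)%N then q%:R * (j + 2)%:R^-1 else 0.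
apply: (@le_trans _ _ (\sum_(0 <= j < q) h j)); last first.
  rewrite -(sum_modn_progression h i cpq); apply: ler_sum_nat => k /andP[_ kq].
  rewrite /h; case: ifP => [/andP[j1 j2]|_].
    have /andP[l1 l2] := loc k kq _ erefl j1 j2.
    set j := (_ %% _)%N in j1 j2 l1 l2 *.
    have jp : 0 < (j + 2)%:R :> R by rewrite ltr0n; lia.
    have y0 : 0 < rot_orbit x k by apply: le_lt_trans l1; rewrite divr_ge0.
    rewrite -[_ * _]invrK invfM invrK lef_pV2 ?posrE//.
      by rewrite mulrC ltW.
    by rewrite mulr_gt0 ?invr_gt0.
  by rewrite invr_ge0; have /andP[] := rot_orbit_bounds x k.
have lnq : ln q%:R <= q%:R :> R by rewrite ltW// ln_sublinear.
case: q {cpq app loc} @h q0 qp lnq => // -[|[|q]] h _ qp lnq.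
- by rewrite big_nat1/= /h/= ln1; lra.
- by rewrite !big_nat_recr//= big_geq//= /h/= !addr0 mulr_ge0_le0//; lra.
rewrite big_nat_recr//= big_nat_recl//=.
rewrite [h 0]/h [h q.+2]/h/= ltnn add0r addr0.
have -> : \sum_(0 <= j < q.+1) h j.+1 =
    q.+3%:R * \sum_(0 <= j < q.+1) (j.+3%:R)^-1.
  rewrite mulr_sumr; apply: eq_big_nat => j /andP[_ jq].
  by rewrite /h/= (_ : (j.+2 < q.+3)%N) ?addn2.
rewrite ler_pM2l//.
have := @ln_le_harmonic R q.+3; rewrite big_nat_recl//= big_nat_recl//=.
have : ln q.+3%:R <= ln q.+4%:R :> R by rewrite ler_ln ?posrE ?ltr0n// ler_nat.
set S := \sum_(_ <= _ < _) _; rewrite invr1.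
have : 2%:R^-1 <= 1 :> R by rewrite invf_le1// ler1n.
lra.
Qed.

Lemma sum_blocks_le g q K b x :
  (forall x, 0 <= x -> \sum_(0 <= k < q) g (rot_orbit x k) <= K) -> 0 <= x ->
  \sum_(0 <= k < b * q) g (rot_orbit x k) <= b%:R * K.
Proof.
move=> hK x0; elim: b => [|b IH]; first by rewrite big_geq// mul0r.
rewrite mulSnr -natr1 mulrDl mul1r (@big_cat_nat _ _ _ (b * q)%N) ?leq_addr//=.
apply: lerD => //; rewrite -{1}[(b * q)%N]add0n big_addn addKn.
under eq_bigr do rewrite addnC rot_orbitD.
by apply: hK; have /andP[] := rot_orbit_bounds x (b * q).
Qed.

Lemma sum_blocks_ge g q K b x :
  (forall x, 0 <= x -> K <= \sum_(0 <= k < q) g (rot_orbit x k)) -> 0 <= x ->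
  b%:R * K <= \sum_(0 <= k < b * q) g (rot_orbit x k).
Proof.
move=> hK x0; rewrite -lerN2 -mulrN -sumrN.
apply: (@sum_blocks_le (fun y => - g y)) => // {}x {}x0.
by rewrite sumrN lerN2 hK.
Qed.

End Blocks.

(** * Roth type in terms of rational approximations *)

Section Roth.
Context {R : realType}.
Variable alpha : R.
Hypotheses (alpha_gt0 : 0 < alpha) (alpha_lt1 : alpha < 1).
Hypothesis alpha_irr : irrational alpha.
Local Notation q_ := (cf_denom alpha).

Lemma near_ge_natr (C : R) : \forall N \near \oo, C <= N%:R.
Proof. exact: nbhs_infty_ger. Qed.

Lemma near_ge_ln (C : R) : \forall N \near \oo, C <= ln N%:R.
Proof.
near=> N; have hN : expR C <= N%:R by near: N; exact: near_ge_natr.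
by rewrite -[C]expRK ler_ln ?posrE ?expR_gt0// (lt_le_trans _ hN)// expR_gt0.
Unshelve. all: by end_near. Qed.

(** The denominator is the largest one below [e N]: the next one exceeds
    [e N], and for Roth type numbers it is hardly larger on the logarithmic
    scale. *)
Lemma roth_approximation : roth_type alpha -> forall e : R, 0 < e -> e < 1 ->
  \forall N \near \oo, exists p q : nat,
    [/\ coprime p q, (0 < q)%N, `|q%:R * alpha - p%:R| <= q%:R^-1,
        q%:R <= e * N%:R & (1 - e) * ln N%:R <= ln q%:R].
Proof.
move=> roth e e0 e1; have e20 : 0 < e / 2 by lra.
have [n0 _ roth0] := roth _ e20.
near=> N.
have eN : (q_ n0.+1)%:R <= e * N%:R.
  rewrite mulrC -ler_pdivrMr//; near: N; exact: near_ge_natr.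
have lnN : - ln e / (e / 2) <= ln N%:R by near: N; exact: near_ge_ln.
have lnN0 : 0 <= ln N%:R :> R by near: N; exact: near_ge_ln.
have eN0 : 0 < e * N%:R by apply: lt_le_trans eN; rewrite ltr0n cf_denom_gt0.
have N0 : 0 < N%:R :> R by move: eN0; rewrite pmulr_rgt0.
have ex : exists n, (q_ n)%:R <= e * N%:R by exists n0.+1.
have bd n : (q_ n)%:R <= e * N%:R -> (n <= (Num.truncn (e * N%:R)).+1)%N.
  case: n => // n; rewrite ltnS -truncn_ge_nat ?ltW//.
  exact/leq_trans/cf_denom_ge.
case: (ex_maxnP ex bd) => n nP nmax.
have n0n : (n0 < n)%N by exact: nmax.
have lt : e * N%:R < (q_ n.+1)%:R.
  by rewrite ltNge; apply/negP => /nmax; rewrite ltnn.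
have := roth0 n (ltnW n0n) => /=.
case: n nP nmax n0n lt => // n nP nmax n0n lt rothn.
have [p [cp _ pq]] := convergent_approx alpha_gt0 alpha_lt1 alpha_irr n.
have qp : 0 < (q_ n.+1)%:R :> R by rewrite ltr0n cf_denom_gt0.
exists p, (q_ n.+1); split => //; first exact: cf_denom_gt0.
  apply: le_trans pq _.
  rewrite lef_pV2 ?posrE ?ltr0n ?cf_denom_gt0// ler_nat.
  exact: cf_denom_leS.
have : ln (e * N%:R) <= (1 + e / 2) * ln (q_ n.+1)%:R.
  rewrite -ln_powR ler_ln ?posrE ?powR_gt0//.
  exact/ltW/(lt_trans lt).
rewrite lnM ?posrE//.
move: lnN; rewrite ler_pdivrMr//.
set L := ln N%:R in lnN0 *; set Q := ln (q_ n.+1)%:R.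
nra.
Unshelve. all: by end_near. Qed.

(** Failure of Roth type gives infinitely many [n] with
    [q_n^(1 + e) <= q_(n+1)]; the approximation is the convergent [p_n/q_n] for
    such an [n]. *)
Lemma not_roth_approximation : ~ roth_type alpha ->
  exists2 e : R, 0 < e & forall C : R, exists p q : nat,
    [/\ coprime p q, (0 < q)%N, C <= q%:R,
        0 < `|q%:R * alpha - p%:R| &
        `|q%:R * alpha - p%:R| <= (q%:R `^ (1 + e))^-1].
Proof.
move=> /existsNP[e /not_implyP[e0 nroth]]; exists e => // C.
apply: contrapT => none; apply: nroth.
exists (Num.truncn C).+2 => // -[//|n]; rewrite /= ltnS => nC.
rewrite ltNge; apply/negP => le; apply: none.
have [p [cp p0 pq]] := convergent_approx alpha_gt0 alpha_lt1 alpha_irr n.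
exists p, (q_ n.+1); split => //; first exact: cf_denom_gt0.
  rewrite ltW// (lt_le_trans (truncnS_gt _))// ler_nat.
  exact: leq_trans nC (cf_denom_ge _ _ _ _).
apply: le_trans pq _.
have q0 : 0 < (q_ n.+1)%:R :> R by rewrite ltr0n cf_denom_gt0.
by rewrite lef_pV2 ?posrE ?powR_gt0// ltr0n cf_denom_gt0.
Qed.

End Roth.

(** * Measure estimates *)

Section Measure.
Context {R : realType}.
Implicit Types (A B : set R).

(** Lebesgue measure is given on all sets by an outer measure, hence is
    monotone on all sets. *)
Lemma lebesgue_measure_le A B : A `<=` B ->
  (lebesgue_measure A <= lebesgue_measure B)%E.
Proof.
rewrite /lebesgue_measure /lebesgue_stieltjes_measure /measure_extension => AB.
by have := @le_mu_ext _ _ _ (wlength idfun) A B AB.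
Qed.

Lemma lebesgue_measure_co (a b : R) : a <= b ->
  lebesgue_measure (`[a, b[ : set R) = (b - a)%:E.
Proof.
rewrite le_eqVlt => /predU1P[->|ab]; rewrite lebesgue_measure_itv/= lte_fin.
  by rewrite ltxx subrr.
by rewrite ab EFinB.
Qed.

Variable alpha : R.

(** The points [x] of the unit interval with [rot_orbit x k < t] lie in two
    translates of an interval of length [t], according to whether [x + beta]
    reaches [1]. The cover may be larger than that set: its measure only matters
    up to a constant factor. *)
Definition visit_cover k (t : R) : set R :=
  let beta := frac_part (k%:R * alpha) in
  `[1 - beta, 1 - beta + t[ `|` `[- beta, - beta + t[.

Lemma measurable_visit_cover k t : measurable (visit_cover k t).
Proof. by apply: measurableU; exact: measurable_itv. Qed.

Lemma lebesgue_measure_visit_cover k t : 0 <= t ->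
  (lebesgue_measure (visit_cover k t) <= (2 * t)%:E)%E.
Proof.
move=> t0; apply: le_trans (measureU2 _ _ _) _; [exact: measurable_itv..|].
rewrite [X in (X + _)%E]lebesgue_measure_co ?lerDl//.
rewrite [X in (_ + X)%E]lebesgue_measure_co ?lerDl//.
by rewrite -EFinD lee_fin; lra.
Qed.

Lemma visit_coverP k t x : 0 <= x < 1 -> rot_orbit alpha x k < t ->
  visit_cover k t x.
Proof.
move=> /andP[x0 x1]; rewrite /visit_cover; set beta := frac_part (k%:R * alpha).
have -> : rot_orbit alpha x k = frac_part (x + beta).
  rewrite /rot_orbit; have [m mE] := frac_partE (k%:R * alpha).
  by rewrite {1}mE addrA frac_partDz.
have /andP[b0 b1] : 0 <= beta < 1 by exact: frac_part_bounds.
have [h|h] := ltP (x + beta) 1.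
  rewrite (@frac_part_id _ (x + beta)) => [xt|]; last first.
    by apply/andP; split; lra.
  right.
  by rewrite /= in_itv/=; apply/andP; split; lra.
rewrite (@frac_part_eq _ (x + beta) (x + beta - 1) 1) => [xt||].
- by left; rewrite /= in_itv/=; apply/andP; split; lra.
- by apply/andP; split; lra.
- by rewrite subrK.
Qed.

(** Markov's inequality for the weighted number of visits: the expected number
    of [k < N] with [rot_orbit alpha x k < t i] is of order [N * t i]. *)
Lemma visits_markov (N J : nat) (w t : nat -> R) (K : R) : 0 < K ->
  (forall i, 0 <= w i) -> (forall i, 0 <= t i) ->
  (lebesgue_measure [set x : R | (0 <= x < 1 /\
     K <= \sum_(0 <= k < N) \sum_(0 <= i < J)
             w i * (rot_orbit alpha x k < t i)%R%:R)%R]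
   <= (2 * N%:R * (\sum_(0 <= i < J) w i * t i) / K)%:E)%E.
Proof.
move=> K0 w0 t0.
pose f k i (x : R) : \bar R := ((w i)%:E * (\1_(visit_cover k (t i)) x)%:E)%E.
pose F (x : R) : \bar R := (\sum_(0 <= k < N) \sum_(0 <= i < J) f k i x)%E.
have mf k i : measurable_fun (setT : set (measurableTypeR R))
    (f k i : _ -> \bar R).
  apply: emeasurable_funM => //; apply/measurable_EFinP.
  apply: measurable_indic; exact: measurable_visit_cover.
have f0 k i x : (0 <= f k i x)%E by rewrite mule_ge0 ?lee_fin.
have mF : measurable_fun (setT : set (measurableTypeR R))
    (F : _ -> \bar R).
  by do 2 (apply: emeasurable_sum => ?).
have F0 x : (0 <= F x)%E by do 2 (apply: sume_ge0 => ? _).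
have intF : (\int[lebesgue_measure]_(x in setT) F x <=
    (2 * N%:R * (\sum_(0 <= i < J) w i * t i))%:E)%E.
  rewrite ge0_integral_sum//=; last 2 first.
  - by move=> k; apply: emeasurable_sum => ?.
  - by move=> k x _; apply: sume_ge0 => ? _.
  apply: (@le_trans _ _
    (\sum_(0 <= k < N) (2 * (\sum_(0 <= i < J) w i * t i))%:E)%E).
    apply: lee_sum => k _; rewrite ge0_integral_sum//=.
    rewrite mulr_sumr -sumEFin; apply: lee_sum => i _.
    rewrite ge0_integralZl_EFin//=; last first.
      apply/measurable_EFinP; apply: measurable_indic.
      exact: measurable_visit_cover.
    rewrite integral_indic//; last exact: measurable_visit_cover.
    rewrite setIT mulrCA EFinM.
    by rewrite lee_wpmul2l ?lee_fin// lebesgue_measure_visit_cover.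
  rewrite sumEFin lee_fin sumr_const_nat subn0 -mulr_natl; lra.
have := @le_integral_abse _ _ _ lebesgue_measure setT measurableT F K mF K0.
under eq_integral do rewrite gee0_abs//.
move=> /le_trans /(_ intF) h.
apply: (@le_trans _ _ (lebesgue_measure [set x | (K%:E <= `|F x|)%E])).
  apply: lebesgue_measure_le => x [x01 Kx] /=.
  rewrite (gee0_abs (F0 x)).
  apply: (@le_trans _ _ (\sum_(0 <= k < N) \sum_(0 <= i < J)
             w i * (rot_orbit alpha x k < t i)%R%:R)%:E).
    by rewrite lee_fin.
  rewrite /F -sumEFin; apply: lee_sum => k _.
  rewrite -sumEFin; apply: lee_sum => i _.
  rewrite EFinM lee_wpmul2l ?lee_fin// indicE.
  case lt: (_ < t i); last by rewrite ler0n.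
  by rewrite mem_set//; exact: visit_coverP.
by rewrite EFinM lee_pdivlMr// muleC; rewrite setTI in h.
Qed.

(** The intervals from [(i + a)/q] to [(i + c)/q] are disjoint and have total
    measure [c - a], so that [B] cannot contain all of them. *)
Lemma exists_grid_point (q : nat) (a c : R) B : (0 < q)%N ->
  0 <= a -> a <= c -> c <= 1 -> (lebesgue_measure B < (c - a)%:E)%E ->
  exists i (v : R), [/\ (i < q)%N, a <= v < c & ~ B (i%:R / q%:R + v / q%:R)].
Proof.
move=> q0 a0 ac c1; have qp : 0 < q%:R :> R by rewrite ltr0n.
apply: contraPP => none; apply/negP; rewrite -leNgt.
pose F i : set (measurableTypeR R) :=
  [set` `[(i%:R + a) / q%:R, (i%:R + c) / q%:R[].
have trivF : trivIset setT F.
  apply: ltn_trivIset => n m mn; apply/seteqP; split => // x [].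
  rewrite /F /= !in_itv/= !ler_pdivrMr// !ltr_pdivlMr//.
  move=> /andP[_ h1] /andP[h2 _].
  have : m.+1%:R <= n%:R :> R by rewrite ler_nat.
  by rewrite -natr1; lra.
have muF : lebesgue_measure (\big[setU/set0]_(i < q) F i) = (c - a)%:E.
  rewrite measure_bigsetU//; last by move=> i; exact: measurable_itv.
  have lF i : lebesgue_measure (F i) = ((c - a) / q%:R)%:E.
    have le : (i%:R + a) / q%:R <= (i%:R + c) / q%:R.
      by rewrite ler_pM2r ?invr_gt0// lerD2l.
    apply: etrans (lebesgue_measure_co le) _.
    by rewrite -mulrBl; congr (_ / _)%:E; ring.
  rewrite (_ : (\sum_(i < q) _)%E = (\sum_(i < q) ((c - a) / q%:R)%:E)%E);
    last by apply: eq_bigr => i _; exact: lF.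
  by rewrite sumEFin sumr_const card_ord -[X in X%:E]mulr_natr divfK// gt_eqF.
rewrite -muF; apply: lebesgue_measure_le => x.
rewrite -bigcup_mkord => -[i /= iq]; rewrite /F/= in_itv/= => xi.
apply: contrapT => nBx; apply: none; exists i, (x * q%:R - i%:R); split => //.
  move: xi; rewrite ler_pdivrMr// ltr_pdivlMr// => /andP[? ?].
  by apply/andP; split; lra.
by rewrite -mulrDl addrC subrK mulfK// gt_eqF.
Qed.

End Measure.

(** * The weak law for Roth type numbers *)

Section WeakLaw.
Context {R : realType}.

Lemma cvge0P (u : nat -> \bar R) : (forall n, 0 <= u n)%E ->
  u n @[n --> \oo] --> 0%E <->
  forall r : R, 0 < r -> \forall n \near \oo, (u n <= r%:E)%E.
Proof.
move=> u0; split => [/fine_cvgP[ufin /cvgr0Pnorm_le cvg] r r0|h].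
  near=> n; rewrite -[leLHS]fineK; last by near: n; exact: ufin.
  rewrite lee_fin; apply: le_trans (ler_norm _) _.
  by near: n; exact: cvg.
apply/fine_cvgP; split.
  near=> n; rewrite ge0_fin_numE//.
  apply: (@le_lt_trans _ _ 1%:E); last exact: ltry.
  by near: n; exact: h.
apply/cvgr0Pnorm_le => r r0; near=> n.
have un : (u n <= r%:E)%E by near: n; exact: h.
have ufin : u n \is a fin_num.
  by rewrite ge0_fin_numE// (le_lt_trans un) ?ltry.
by rewrite /= ger0_norm ?fine_ge0// -lee_fin fineK.
Unshelve. all: by end_near. Qed.

(** The range between [expR (- I) t] and [t] is cut geometrically: [1/y] is at
    most a sum of indicators of intervals starting at [0], each of weight
    inversely proportional to its length, so that all have the same integral. *)
Lemma inv_le_slices (t y : R) I : 0 < t -> expR (- I%:R) * t <= y -> y < t ->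
  y^-1 <= \sum_(0 <= i < I) expR i.+1%:R / t * (y < expR (- i%:R) * t)%R%:R.
Proof.
move=> t0; elim: I => [|I IH] Iy yt.
  by move: Iy; rewrite oppr0 expR0 mul1r leNgt yt.
rewrite big_nat_recr//=.
have pos (i : nat) : 0 <= expR i.+1%:R / t by rewrite divr_ge0 ?expR_ge0 ?ltW.
have [h|h] := leP (expR (- I%:R) * t) y.
  by rewrite mulr0 addr0; exact: IH.
rewrite mulr1 ler_wpDl ?sumr_ge0// => [i _|]; first by rewrite mulr_ge0.
have e0 : 0 < expR (- I.+1%:R) * t by rewrite mulr_gt0 ?expR_gt0.
have -> : expR I.+1%:R / t = (expR (- I.+1%:R) * t)^-1.
  by rewrite invfM expRN invrK.
by rewrite lef_pV2 ?posrE// (lt_le_trans e0).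
Qed.

(** The arithmetic of the weak law: [n], [m], [l], [L], [S] stand for [N], [q],
    [ln q], [ln N] and the Birkhoff sum. *)
Lemma relative_deviation_le (eps e n m l L S : R) : 0 < eps ->
  0 < e -> e <= 2^-1 -> e <= eps / 6 -> 0 < n -> 0 <= m -> m <= e * n ->
  (1 - e) * L <= l -> l <= L -> 4 <= e * L ->
  (n - m) * (l - 2) <= S -> S <= (n + m) * (4 + l) + eps / 2 * (n * L) ->
  `|S / (n * L) - 1| <= eps.
Proof.
move=> eps0 e0 e2 e6 n0 m0 mn lL1 lL2 eL low up.
have L0 : 0 < L by nra.
have nL : 0 < n * L by rewrite mulr_gt0.
have nL' := ltW nL.
rewrite ler_norml lerBlDr lerBrDr; apply/andP; split.
  rewrite ler_pdivlMr//; apply: le_trans low.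
  have A : (1 - e) * n <= n - m by lra.
  have B : (1 - 2 * e) * L <= l - 2 by lra.
  have e1 : 0 <= (1 - e) * n by rewrite mulr_ge0 ?(ltW n0)//; lra.
  have e3 : 0 <= (1 - 2 * e) * L by rewrite mulr_ge0 ?(ltW L0)//; lra.
  apply: le_trans (ler_pM e1 e3 A B).
  by rewrite mulrACA ler_wpM2r//; nra.
rewrite ler_pdivrMr//; apply: le_trans up _.
have A : n + m <= (1 + e) * n by lra.
have B : 4 + l <= (1 + e) * L by lra.
have C : 0 <= 4 + l by nra.
have D : 0 <= n + m by lra.
apply: le_trans (lerD (ler_pM D C A B) (lexx _)) _.
by rewrite mulrACA -mulrDl ler_wpM2r//; nra.
Qed.

Variable alpha : R.

(** The intervals whose visits are counted: index [0] is for the points so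
    close to [0] that with high probability there are none, and the others are
    those of [inv_le_slices] for [t = 1/q]. *)
Definition slice_length (q N : nat) (delta : R) (i : nat) : R :=
  if i is j.+1 then expR (- j%:R) / q%:R else delta / N%:R.

Definition slice_weight (q : nat) (K : R) (i : nat) : R :=
  if i is j.+1 then expR j.+1%:R * q%:R else K.

(** The Birkhoff sum is split at [1/q]: the points above contribute at most the
    sums over blocks, the others at most the weighted count of their visits,
    in which a single visit below [delta/N] already counts for [K]. *)
Lemma birkhoff_sum_le p q N I (delta K x : R) : coprime p q -> (0 < q)%N ->
  (q <= N)%N -> `|q%:R * alpha - p%:R| <= q%:R^-1 ->
  0 < K -> N%:R / q%:R <= delta * expR I%:R -> 0 <= x < 1 ->
  \sum_(0 <= k < N) \sum_(0 <= i < I.+1) slice_weight q K i *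
     (rot_orbit alpha x k < slice_length q N delta i)%R%:R < K ->
  birkhoff_sum alpha (@recip R) N x <= (N + q)%:R * (4 + ln q%:R) + K.
Proof.
move=> cpq q0 qN app K0 NqI x01 FK; have /andP[x0 x1] := x01.
have qp : 0 < q%:R :> R by rewrite ltr0n.
have Np : 0 < N%:R :> R by rewrite ltr0n (leq_trans q0).
have w0 i : 0 <= slice_weight q K i.
  by case: i => [|i] /=; [exact: ltW | rewrite mulr_ge0 ?expR_ge0].
pose g (y : R) := if y < q%:R^-1 then 0 else y^-1.
have g0 y : 0 <= y -> 0 <= g y by rewrite /g; case: ifP; rewrite ?invr_ge0.
rewrite birkhoff_sumE// /recip.
apply: (@le_trans _ _ (\sum_(0 <= k < N) (g (rot_orbit alpha x k) +
  \sum_(0 <= i < I.+1) slice_weight q K i *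
     (rot_orbit alpha x k < slice_length q N delta i)%R%:R))); last first.
  rewrite big_split/= lerD//; last exact: ltW.
  set b := (N %/ q).+1.
  have Nb : (N <= b * q)%N by rewrite ltnW// ltn_ceil.
  apply: (@le_trans _ _ (\sum_(0 <= k < b * q) g (rot_orbit alpha x k))).
    rewrite [leRHS](@big_cat_nat _ _ _ N)//= lerDl sumr_ge0// => k _.
    by apply: g0; have /andP[] := rot_orbit_bounds alpha x k.
  apply: le_trans (sum_blocks_le (K := q%:R * (4 + ln q%:R)) _ _ x0) _.
    move=> z z0.
    apply: le_trans (@sum_block_le _ _ g p q z q%:R cpq z0 _ app _ _) _ => //.
    - move=> y _; rewrite /g; case: ltP => [_|yq]; first exact: ltW.
      rewrite -[leRHS]invrK lef_pV2 ?posrE ?invr_gt0//.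
      by rewrite (lt_le_trans _ yq)// invr_gt0.
    - move=> y /andP[y0 _]; rewrite /g; case: ifP => // _.
      by rewrite invr_ge0 ltW.
    - by rewrite !mulrDr mulr1; lra.
  rewrite mulrA ler_wpM2r//; first by rewrite addr_ge0// ln_ge0// ler1n.
  by rewrite -natrM ler_nat /b mulSnr leq_add2r leq_trunc_div.
apply: ler_sum_nat => k /andP[_ kN]; set y := rot_orbit alpha x k.
have /andP[y0 y1] : 0 <= y < 1 by exact: rot_orbit_bounds.
have Fy : \sum_(0 <= i < I.+1) slice_weight q K i *
     (y < slice_length q N delta i)%R%:R < K.
  apply: le_lt_trans FK; rewrite [leRHS](big_rem k) ?mem_index_iota//= lerDl.
  by do 2 (apply: sumr_ge0 => ? _); rewrite mulr_ge0.
have [yq|yq] := ltP y q%:R^-1; last first.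
  rewrite /g ltNge yq/= lerDl sumr_ge0// => i _.
  by rewrite mulr_ge0.
rewrite /g yq add0r.
move: Fy; rewrite big_nat_recl//= => Fy.
have [ydelta|ydelta] := ltP y (delta / N%:R).
  suff : K < K by rewrite ltxx.
  move: Fy; rewrite ydelta mulr1; apply: le_lt_trans.
  by rewrite lerDl sumr_ge0// => i _; exact: (mulr_ge0 (w0 i.+1)).
rewrite mulr0 add0r.
have := @inv_le_slices q%:R^-1 y I _ _ yq; rewrite invr_gt0 invrK; apply => //.
apply: le_trans ydelta.
rewrite expRN ler_pdivlMr// mulrAC ler_pdivrMr// mulrC -ler_pdivrMr ?expR_gt0//.
by rewrite mulrAC ler_pdivrMr ?expR_gt0.
Qed.

Lemma birkhoff_sum_ge p q N (x : R) :
  coprime p q -> (0 < q)%N -> 2 <= ln q%:R :> R ->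
  `|q%:R * alpha - p%:R| <= q%:R^-1 -> 0 <= x < 1 ->
  (N%:R - q%:R) * (ln q%:R - 2) <= birkhoff_sum alpha (@recip R) N x.
Proof.
move=> cpq q0 lnq app x01; have /andP[x0 _] := x01.
have qp : 0 < q%:R :> R by rewrite ltr0n.
rewrite birkhoff_sumE// /recip.
apply: (@le_trans _ _
  (\sum_(0 <= k < N %/ q * q) (rot_orbit alpha x k)^-1)); last first.
  rewrite [leRHS](@big_cat_nat _ _ _ (N %/ q * q)%N) ?leq_trunc_div//=.
  rewrite lerDl sumr_ge0// => k _.
  by rewrite invr_ge0; have /andP[] := rot_orbit_bounds alpha x k.
apply: le_trans (@sum_blocks_ge _ alpha (fun y => y^-1) q
  (q%:R * (ln q%:R - 2)) (N %/ q)%N x _ x0); last first.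
  by move=> z z0; exact: (sum_block_ge cpq).
rewrite mulrA ler_wpM2r ?subr_ge0// lerBlDr -natrM -natrD ler_nat.
by rewrite -mulSnr ltnW// ltn_ceil.
Qed.

(** Roth type makes every [N] comparable, on a logarithmic scale, to the
    denominator [q] of a good approximation that is still a small multiple of
    [N]. Then the points above [1/q] contribute [N ln N (1 + o(1))] uniformly in
    [x], and the slices between [delta/N] and [1/q], of which there are few,
    contribute in mean a small multiple of [N ln N]. *)
Lemma roth_weak_law (d : nat -> R) : 0 < alpha -> alpha < 1 ->
  irrational alpha -> roth_type alpha ->
  (forall N : nat, (2 <= N)%N -> d N = N%:R * ln N%:R) ->
  weak_law alpha (@recip R) d.
Proof.
move=> a0 a1 airr roth dE eps eps0; apply/cvge0P => [N|r r0].
  exact: measure_ge0.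
set E := expR (1 : R); have E0 : 0 < E by exact: expR_gt0.
(* excluding visits below [delta/N] costs measure [2 delta <= r/2] *)
pose delta := Num.min 1 (r / 4).
have delta0 : 0 < delta by rewrite lt_min ltr01 divr_gt0.
have delta1 : delta <= 1 by rewrite ge_min lexx.
have deltar : 2 * delta <= r / 2.
  have : delta <= r / 4 by rewrite ge_min lexx orbT.
  lra.
(* [eps/6] serves the deterministic bounds and [r eps/(16 E)] makes the slices
   cost measure at most [r/2] *)
pose e := Num.min (2^-1) (Num.min (eps / 6) (r * eps / (16 * E))).
have e0 : 0 < e.
  by rewrite !lt_min invr_gt0 ltr0n !divr_gt0// ?mulr_gt0.
have e2 : e <= 2^-1 by rewrite ge_min lexx.
have e6 : e <= eps / 6 by rewrite !ge_min lexx orbT.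
have eE : e * (16 * E) <= r * eps.
  by rewrite -ler_pdivlMr ?mulr_gt0// !ge_min lexx !orbT.
have e1 : e < 1 by lra.
have appN := roth_approximation a0 a1 airr roth e0 e1.
near=> N.
have [p [q [cpq q0 app qe lnq]]] : exists p q : nat,
    [/\ coprime p q, (0 < q)%N, `|q%:R * alpha - p%:R| <= q%:R^-1,
        q%:R <= e * N%:R & (1 - e) * ln N%:R <= ln q%:R].
  by near: N; exact: appN.
have qp : 0 < q%:R :> R by rewrite ltr0n.
have Np : 0 < N%:R :> R by have := lt_le_trans qp qe; rewrite pmulr_rgt0.
have qN : (q <= N)%N by rewrite -(ler_nat R); nra.
have lnqN : ln q%:R <= ln N%:R :> R by rewrite ler_ln ?posrE// ler_nat.
have N2 : (2 <= N)%N by near: N; exact: nbhs_infty_ge.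
have L1 : 4 <= e * ln N%:R.
  by rewrite mulrC -ler_pdivrMr//; near: N; exact: near_ge_ln.
have L2 : 1 - ln delta <= e * ln N%:R.
  by rewrite mulrC -ler_pdivrMr//; near: N; exact: near_ge_ln.
set L := ln N%:R in lnq lnqN L1 L2 *.
have L0 : 0 < L by nra.
pose K := eps / 2 * (N%:R * L).
have K0 : 0 < K by rewrite !mulr_gt0// invr_gt0.
(* the number of slices, reaching from [1/q] down to [delta/N] *)
pose I := (Num.truncn (ln (N%:R / q%:R / delta))).+1.
have NqI : N%:R / q%:R <= delta * expR I%:R.
  rewrite [leRHS]mulrC -ler_pdivrMr// -[leLHS]lnK ?posrE ?divr_gt0//.
  by rewrite ler_expR ltW// truncnS_gt.
have IL : I%:R <= 2 * e * L.
  have lnE : ln (N%:R / q%:R / delta) = L - ln q%:R - ln delta.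
    by rewrite !ln_div ?posrE ?divr_gt0.
  have ge0 : 0 <= ln (N%:R / q%:R / delta).
    rewrite ln_ge0// ler_pdivlMr// mul1r (le_trans delta1)// ler_pdivlMr//.
    by rewrite mul1r ler_nat.
  have : (Num.truncn (ln (N%:R / q%:R / delta)))%:R <=
      ln (N%:R / q%:R / delta) by rewrite truncn_le.
  by rewrite /I -natr1 lnE; lra.
apply: (@le_trans _ _ (lebesgue_measure [set x : R | (0 <= x < 1 /\
     K <= \sum_(0 <= k < N) \sum_(0 <= i < I.+1) slice_weight q K i *
     (rot_orbit alpha x k < slice_length q N delta i)%R%:R)%R])).
  apply: lebesgue_measure_le => x /= []; rewrite in_itv/= => x01.
  rewrite dE// -/L => bad; split => //.
  rewrite leNgt; apply: contraTN bad => FK; rewrite -leNgt.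
  have up := birkhoff_sum_le cpq q0 qN app K0 NqI x01 FK.
  have lnq2 : 2 <= ln q%:R :> R by nra.
  have low := @birkhoff_sum_ge p q N x cpq q0 lnq2 app x01.
  rewrite natrD in up.
  exact: (relative_deviation_le eps0 e0 e2 e6 Np (ltW qp) qe lnq lnqN L1 low
    up).
apply: le_trans (visits_markov alpha N I.+1 K0 _ _) _.
- by case=> [|i] /=; [exact: ltW | rewrite mulr_ge0 ?expR_ge0].
- by case=> [|i] /=; [rewrite divr_ge0// ltW | rewrite divr_ge0 ?expR_ge0].
rewrite lee_fin big_nat_recl//=.
rewrite (_ : \sum_(0 <= i < I) _ = I%:R * E); last first.
  rewrite (eq_bigr (fun=> E)) => [|i _]; last first.
    rewrite mulrACA divff ?gt_eqF// mulr1 -expRD /E; congr expR.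
    by rewrite -natr1; ring.
  by rewrite sumr_const_nat subn0 mulr_natl.
rewrite ler_pdivrMr//.
rewrite [leLHS](_ : _ = 2 * delta * K + 2 * N%:R * (I%:R * E)); last first.
  by field; rewrite gt_eqF.
have : 2 * delta * K <= r / 2 * K by rewrite ler_wpM2r// ltW.
suff : 2 * N%:R * (I%:R * E) <= r / 2 * K by lra.
have : N%:R * (I%:R * E) <= N%:R * (2 * e * L * E).
  by rewrite ler_wpM2l// ler_wpM2r// ltW.
have : e * (16 * E) * (N%:R * L) <= r * eps * (N%:R * L).
  by rewrite ler_wpM2r// mulr_ge0// ltW.
rewrite /K; lra.
Unshelve. all: by end_near. Qed.
End WeakLaw.

(** * Two behaviours at a very good approximation *)

Lemma progression_sum_ge (R : realType) (eta X : R) (y : nat -> R) m :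
  0 < eta -> 0 < X -> X <= m.+1%:R ->
  (forall j, (j < m)%N -> 0 < y j <= j.+1%:R * eta) ->
  eta^-1 * ln X <= \sum_(0 <= j < m) (y j)^-1.
Proof.
move=> eta0 X0 Xm hy.
apply: (@le_trans _ _ (eta^-1 * \sum_(0 <= j < m) (j.+1%:R)^-1)).
  rewrite ler_pM2l ?invr_gt0//; apply: le_trans (@ln_le_harmonic R m).
  by rewrite ler_ln ?posrE ?ltr0n.
rewrite mulr_sumr; apply: ler_sum_nat => j /andP[_ jm].
have /andP[y0 yle] := hy j jm.
rewrite -invfM lef_pV2 ?posrE ?mulr_gt0 ?ltr0n//.
by rewrite mulrC.
Qed.

Lemma sum_subprogression (R : realType) (F : nat -> R) (q k0 b m n : nat) :
  (forall k, 0 <= F k) -> (k0 < q)%N -> (n <= b)%N -> (m <= n)%N ->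
  \sum_(m <= j < n) F (k0 + j * q)%N <= \sum_(0 <= k < b * q) F k.
Proof.
move=> F0 k0q nb mn; rewrite big_nat_mul.
apply: (@le_trans _ _ (\sum_(0 <= j < b) F (k0 + j * q)%N)).
  rewrite [leRHS](@big_cat_nat _ _ _ n)//=.
  rewrite [X in _ <= X + _](@big_cat_nat _ _ _ m)//=.
  rewrite -addrA addrCA lerDl addr_ge0// sumr_ge0//.
apply: ler_sum => j _; rewrite (bigD1_seq (k0 + j * q)%N) ?iota_uniq//=.
  by rewrite lerDl sumr_ge0.
by rewrite mem_index_iota leq_addl mulSn ltn_add2r.
Qed.

Section Converse.
Context {R : realType}.
Variables (alpha : R) (p q : nat).
Hypotheses (cpq : coprime p q) (q0 : (0 < q)%N).

Local Notation eta := `|q%:R * alpha - p%:R|.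

(** As long as the drift [N eta/q] is at most [1/(8q)], an orbit starting in the
    middle part of a cell of the grid of step [1/q] stays away from the grid. *)
Lemma birkhoff_sum_le_mid (b i : nat) (v : R) :
  b%:R * q%:R * eta <= 8^-1 -> eta <= q%:R^-1 -> (i < q)%N ->
  3 / 8 <= v < 5 / 8 ->
  birkhoff_sum alpha (@recip R) (b * q) (i%:R / q%:R + v / q%:R) <=
  b%:R * q%:R * (13 + ln q%:R).
Proof.
move=> bq app iq /andP[v1 v2].
have qp : 0 < q%:R :> R by rewrite ltr0n.
have x01 : 0 <= i%:R / q%:R + v / q%:R < 1.
  by apply: grid_point_bounds => //; apply/andP; split; lra.
have /andP[x0 _] := x01.
(* no orbit point is below [t], so capping the inverse changes nothing *)
pose t : R := (4 * q%:R)^-1; have t0 : 0 < t by rewrite invr_gt0 mulr_gt0.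
pose g (y : R) := if y < t then 0 else y^-1.
rewrite birkhoff_sumE//.
rewrite (eq_big_nat _ _
  (F2 := fun k => g (rot_orbit alpha (i%:R / q%:R + v / q%:R) k))).
  rewrite -mulrA; apply: sum_blocks_le x0 => z z0.
  apply: le_trans
    (@sum_block_le _ _ g p q z (4 * q%:R) cpq z0 _ app _ _) _.
  - by rewrite mulr_ge0.
  - move=> y _; rewrite /g; case: ltP => [_|yt]; first by rewrite mulr_ge0.
    rewrite -[leRHS]invrK lef_pV2 ?posrE//.
    exact: lt_le_trans yt.
  - move=> y /andP[y0 _]; rewrite /g; case: ifP => // _.
    by rewrite invr_ge0 ltW.
  - by rewrite !mulrDr mulr1; lra.
move=> k /andP[_ kN]; rewrite /g ltNge -/(rot_orbit _ _ _).
suff -> : t <= rot_orbit alpha (i%:R / q%:R + v / q%:R) k by [].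
rewrite (@rot_orbit_lift _ _ p)//.
set j := (_ %% _)%N; set theta := alpha - _.
have jq : j%:R + 1 <= q%:R :> R by rewrite natr1 ler_nat ltn_mod.
have kth : `|k%:R * theta * q%:R| <= 8^-1.
  have -> : k%:R * theta * q%:R = k%:R * (q%:R * alpha - p%:R).
    by rewrite /theta; field; lra.
  rewrite normrM ger0_norm//; apply: le_trans bq.
  by rewrite ler_wpM2r// -natrM ler_nat ltnW.
move: kth; rewrite ler_norml => /andP[h1 h2].
have j0 : 0 <= j%:R :> R by [].
have -> : j%:R / q%:R + (v / q%:R + k%:R * theta) =
          (j%:R + v + k%:R * theta * q%:R) / q%:R by field; lra.
rewrite frac_part_id.
  rewrite /t invfM ler_wpM2r ?invr_ge0//; lra.
rewrite ler_pdivlMr// ltr_pdivrMr// mul0r mul1r.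
by apply/andP; split; lra.
Qed.

Hypothesis eta0 : 0 < eta.
(** The orbit points at the [b] times of one residue class modulo [q] form an
    arithmetic progression of step [eta] and length about [c/q], that is about
    [X] steps. Up to one step it starts at distance between [c/(4q)] and
    [c/(2q)] to the left of [0]. It therefore crosses [0] and has about [X/4]
    points or more to the right of it, whose inverses are at least those of the
    multiples of [eta]. *)
Lemma crossing_cluster_pos (c X : R) b i (v : R) :
  0 < c -> c <= 8^-1 -> X * eta = c / q%:R -> 8 <= X ->
  b%:R <= X -> X < b%:R + 1 -> p%:R < q%:R * alpha ->
  (i < q)%N -> 1 - c / 2 <= v < 1 - c / 2 + c / 4 ->
  eta^-1 * ln (X / 4) <=
  birkhoff_sum alpha (@recip R) (b * q) (i%:R / q%:R + v / q%:R).
Proof.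
move=> c0 c1 XE X8 bX Xb pa iq /andP[v1 v2].
have qp : 0 < q%:R :> R by rewrite ltr0n.
have q1 : 1 <= q%:R :> R by rewrite ler1n.
have x01 : 0 <= i%:R / q%:R + v / q%:R < 1.
  by apply: grid_point_bounds => //; apply/andP; split; lra.
have [k0 k0q k0E] : exists2 k, (k < q)%N & ((i + k * p) %% q)%N = q.-1.
  by apply: modn_progression_onto => //; rewrite prednK.
set theta := alpha - p%:R / q%:R.
have etaE : eta = q%:R * theta.
  by rewrite ger0_norm ?subr_ge0 ?ltW// /theta; field; lra.
have theta0 : 0 < theta by move: eta0; rewrite etaE pmulr_rgt0.
have k0th : k0%:R * theta <= eta by rewrite etaE ler_pM2r// ler_nat ltnW.
have k0th0 : 0 <= k0%:R * theta by rewrite mulr_ge0// ltW.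
pose W := (1 - v) / q%:R - k0%:R * theta.
have w1 : 0 < (1 - v) / q%:R by rewrite divr_gt0//; lra.
have w2 : (1 - v) / q%:R <= X / 2 * eta.
  by rewrite mulrAC XE -mulrAC ler_pM2r ?invr_gt0//; lra.
have We : 0 <= W / eta + 1.
  rewrite -[X in _ + X](@divff _ eta) ?gt_eqF// -mulrDl divr_ge0 ?(ltW eta0)//.
  by rewrite /W; lra.
(* the first step after the crossing *)
pose J := Num.truncn (W / eta + 1).
have /andP[J1 J2] := truncn_itv We.
rewrite -/J in J1 J2.
have J1' : (J%:R - 1) * eta <= W by rewrite -ler_pdivlMr//; lra.
have J2' : W < J%:R * eta.
  by rewrite -ltr_pdivrMr//; move: J2; rewrite -natr1; lra.
have JX : J%:R <= X / 2 + 1.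
  suff : J%:R - 1 <= X / 2 by lra.
  by rewrite -(ler_pM2r eta0); apply: le_trans J1' _; rewrite /W; lra.
have Jb : (J <= b)%N by rewrite -(ler_nat R); lra.
rewrite birkhoff_sumE//.
set x := i%:R / q%:R + v / q%:R in x01 *.
pose F k := recip (rot_orbit alpha x k).
have F0 k : 0 <= F k.
  by rewrite invr_ge0; have /andP[] := rot_orbit_bounds alpha x k.
apply: le_trans (sum_subprogression F0 k0q (leqnn b) Jb).
rewrite -{1}[J]add0n big_addn; apply: progression_sum_ge => //; first by lra.
  by rewrite -[leRHS]natr1 natrB//; lra.
move=> j jm; set k := (_ + _)%N.
suff -> : rot_orbit alpha x k = (j%:R + J%:R) * eta - W.
  have j0 : 0 <= j%:R * eta by rewrite mulr_ge0// ltW.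
  by rewrite -[j.+1%:R]natr1; clear - j0 J1' J2'; apply/andP; split; lra.
rewrite (@rot_orbit_lift _ _ p)// -/theta.
have -> : ((i + k * p) %% q)%N = q.-1.
  by rewrite /k mulnDl addnA mulnAC addnC modnMDl k0E.
rewrite -[q.-1%:R](addrK 1) natr1 prednK//.
have kE : k%:R * theta = k0%:R * theta + (j%:R + J%:R) * eta.
  by rewrite etaE /k natrD natrM natrD; move: (theta) => u; ring.
apply: (@frac_part_eq _ _ _ 1); last first.
  by rewrite kE /W !mulrBl divff ?gt_eqF//; ring.
have jb : (j%:R + J%:R) + 1 <= b%:R :> R.
  by rewrite -natrD natr1 ler_nat addnC -ltn_subRL.
have bq : b%:R * eta <= 8^-1.
  apply: (@le_trans _ _ (X * eta)); first by rewrite ler_pM2r.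
  rewrite XE ler_pdivrMr//; apply: le_trans c1 _.
  by rewrite ler_peMr.
have We' : - eta < W by rewrite /W; lra.
have z1 : ((j%:R + J%:R) + 1) * eta <= b%:R * eta by rewrite ler_pM2r.
have z0 : 0 <= j%:R * eta by rewrite mulr_ge0// ltW.
rewrite mulrDl mul1r in z1; rewrite mulrDl in z1 *.
by clear - J2' We' bq z0 z1; apply/andP; split; lra.
Qed.

(** The mirror image of [crossing_cluster_pos]: the progression starts to the
    right of [0] and moves to the left, and the points before the crossing are
    those that count, in reverse order. *)
Lemma crossing_cluster_neg (c X : R) b i (v : R) :
  0 < c -> c <= 8^-1 -> X * eta = c / q%:R -> 8 <= X ->
  b%:R <= X -> X < b%:R + 1 -> q%:R * alpha < p%:R ->
  (i < q)%N -> c / 4 <= v < c / 4 + c / 4 ->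
  eta^-1 * ln (X / 4) <=
  birkhoff_sum alpha (@recip R) (b * q) (i%:R / q%:R + v / q%:R).
Proof.
move=> c0 c1 XE X8 bX Xb pa iq /andP[v1 v2].
have qp : 0 < q%:R :> R by rewrite ltr0n.
have q1 : 1 <= q%:R :> R by rewrite ler1n.
have x01 : 0 <= i%:R / q%:R + v / q%:R < 1.
  by apply: grid_point_bounds => //; apply/andP; split; lra.
have [k0 k0q k0E] : exists2 k, (k < q)%N & ((i + k * p) %% q)%N = 0%N.
  exact: modn_progression_onto.
set theta := alpha - p%:R / q%:R.
have etaE : eta = - (q%:R * theta).
  by rewrite ltr0_norm ?subr_lt0// /theta; field; lra.
have theta0 : theta < 0.
  by move: eta0; rewrite etaE -mulrN pmulr_rgt0// oppr_gt0.
have k0th : - (k0%:R * theta) <= eta.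
  by rewrite etaE -!mulrN ler_pM2r ?oppr_gt0// ler_nat ltnW.
have k0th0 : k0%:R * theta <= 0 by rewrite mulr_ge0_le0// ltW.
pose W := v / q%:R + k0%:R * theta.
have w1 : X / 4 * eta <= v / q%:R.
  by rewrite mulrAC XE -mulrAC ler_pM2r ?invr_gt0//; lra.
have w2 : v / q%:R <= X / 2 * eta.
  by rewrite mulrAC XE -mulrAC ler_pM2r ?invr_gt0//; lra.
have W1 : (X / 4 - 1) * eta <= W by rewrite /W; lra.
have We : eta <= W.
  by apply: le_trans W1; rewrite ler_peMl ?(ltW eta0)//; lra.
have exn : exists n : nat, W <= n%:R * eta.
  exists (Num.truncn (W / eta)).+1; rewrite -ler_pdivrMr//.
  exact/ltW/truncnS_gt.
(* the number of steps before the crossing *)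
case: (ex_minnP exn) => n nW nmin.
have n0 : (0 < n)%N.
  rewrite lt0n; apply/eqP => nE; move: nW.
  by rewrite nE mul0r leNgt (lt_le_trans eta0).
have n1W : (n%:R - 1) * eta < W.
  rewrite ltNge; apply/negP; rewrite -[n]prednK// -natr1 addrK => /nmin.
  by rewrite leqNgt prednK// leqnn.
have nX : n%:R < X / 2 + 1.
  suff : n%:R - 1 < X / 2 by lra.
  rewrite -(ltr_pM2r eta0); apply: lt_le_trans n1W _.
  by apply: le_trans w2; rewrite /W gerDl.
have nX' : X / 4 - 1 <= n%:R by rewrite -(ler_pM2r eta0) (le_trans W1).
have nb : (n <= b)%N by rewrite -(ler_nat R); lra.
rewrite birkhoff_sumE//.
set x := i%:R / q%:R + v / q%:R in x01 *.
pose F k := recip (rot_orbit alpha x k).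
have F0 k : 0 <= F k.
  by rewrite invr_ge0; have /andP[] := rot_orbit_bounds alpha x k.
apply: le_trans (sum_subprogression F0 k0q nb (leq0n n)).
rewrite big_nat_rev; apply: progression_sum_ge => //; first by lra.
  by rewrite -[leRHS]natr1; lra.
move=> j jn; set k := (_ + _)%N.
suff -> : rot_orbit alpha x k = W - (n%:R - j.+1%:R) * eta.
  have : 0 <= j%:R * eta by rewrite mulr_ge0// ltW.
  rewrite -[j.+1%:R]natr1; clear - n1W nW => ?.
  by apply/andP; split; lra.
rewrite (@rot_orbit_lift _ _ p)// -/theta.
have -> : ((i + k * p) %% q)%N = 0%N.
  by rewrite /k mulnDl addnA mulnAC addnC modnMDl k0E.
have kE : k%:R * theta = k0%:R * theta - (n%:R - j.+1%:R) * eta.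
  rewrite etaE /k natrD natrM natrB//; move: (theta) (j.+1) => u w; ring.
rewrite kE mul0r add0r addrA -/W frac_part_id//.
have vq : v / q%:R < 1 by rewrite ltr_pdivrMr// mul1r; lra.
have Wv : W <= v / q%:R by rewrite /W gerDl.
have nj : j.+1%:R <= n%:R :> R by rewrite ler_nat.
have z0 : 0 <= (n%:R - j.+1%:R) * eta by rewrite mulr_ge0 ?subr_ge0// ltW.
have z1 : (n%:R - j.+1%:R) * eta <= (n%:R - 1) * eta.
  by rewrite ler_pM2r// lerD2l lerN2 ler1n.
by clear - vq Wv z0 z1 n1W; apply/andP; split; lra.
Qed.

End Converse.

(** * The weak law forces Roth type *)

Section Dichotomy.
Context {R : realType}.
Variable alpha : R.

Lemma crossing_interval (p q b : nat) (c X : R) : coprime p q -> (0 < q)%N ->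
  0 < `|q%:R * alpha - p%:R| -> 0 < c -> c <= 8^-1 ->
  X * `|q%:R * alpha - p%:R| = c / q%:R -> 8 <= X ->
  b%:R <= X -> X < b%:R + 1 ->
  exists a : R, [/\ 0 <= a, a + c / 4 <= 1 &
    forall i v, (i < q)%N -> a <= v < a + c / 4 ->
      `|q%:R * alpha - p%:R|^-1 * ln (X / 4) <=
      birkhoff_sum alpha (@recip R) (b * q) (i%:R / q%:R + v / q%:R)].
Proof.
move=> cpq q0 eta0 c0 c1 XE X8 bX Xb.
have [lt|gt|eq] := ltgtP (q%:R * alpha) p%:R.
- exists (c / 4); split; [lra | lra |] => i v iq hv.
  exact: (crossing_cluster_neg cpq q0 eta0 c0 c1 XE X8 bX Xb lt iq hv).
- exists (1 - c / 2); split; [lra | lra |] => i v iq hv.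
  exact: (crossing_cluster_pos cpq q0 eta0 c0 c1 XE X8 bX Xb gt iq hv).
- by move: eta0; rewrite eq subrr normr0 ltxx.
Qed.

Lemma normalized_lt_double (d s1 s2 : R) : 0 < d ->
  `|s1 / d - 1| <= 4^-1 -> `|s2 / d - 1| <= 4^-1 -> s2 < 2 * s1.
Proof.
move=> d0; rewrite !ler_norml => /andP[h1 _] /andP[_ h2].
have : 3 / 4 * d <= s1 by rewrite -ler_pdivlMr//; lra.
have : s2 <= 5 / 4 * d by rewrite -ler_pdivrMr//; lra.
lra.
Qed.

(** Let [eta = |q alpha - p| <= q^(- 1 - e)] and [N = b q] of order [c/eta]. On
    the set of [birkhoff_sum_le_mid] the Birkhoff sum is at most of order
    [(c/eta) ln q]; on that of [crossing_interval] it is at least of order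
    [(1/eta) ln (c/(q eta))], hence [(e/eta) ln q]. Both sets have measure
    bounded below, and for [c] small compared to [e] the second value is at
    least twice the first: no normalisation brings both close to [1]. *)
Lemma weak_law_roth (d : nat -> R) : 0 < alpha -> alpha < 1 ->
  irrational alpha -> (forall N, 0 < d N) -> weak_law alpha (@recip R) d ->
  roth_type alpha.
Proof.
move=> a0 a1 airr d0 wl; apply: contrapT => nroth.
have [e e0 approx] := not_roth_approximation a0 a1 airr nroth.
(* [1/8] keeps the drift small and [e/4] makes the lower bound dominate *)
pose c := Num.min 8^-1 (e / 4).
have c0 : 0 < c by rewrite lt_min invr_gt0 ltr0n divr_gt0.
have c1 : c <= 8^-1 by rewrite ge_min lexx.
have ce : c <= e / 4 by rewrite ge_min lexx orbT.
have quarter : 0 < 4^-1 :> R by rewrite invr_gt0.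
have c8 : 0 < c / 8 by rewrite divr_gt0.
move/cvge0P: (wl _ quarter) => /(_ (fun N => measure_ge0 _ _) _ c8) [N0 _ hN0].
(* above [C1], half of [e ln q] absorbs the constants of the comparison *)
pose C1 := (13 * e / 2 + ln 8 - ln c) / (e / 2).
have [p [q [cpq q0 Cq eta0 etale]]] :=
  approx (Num.max N0%:R (expR (Num.max 0 C1))).
set eta := `|q%:R * alpha - p%:R| in eta0 etale.
have qp : 0 < q%:R :> R by rewrite ltr0n.
move: Cq; rewrite ge_max ler_nat => /andP[N0q Cq].
have : Num.max 0 C1 <= ln q%:R by rewrite -[leLHS]expRK ler_ln ?posrE ?expR_gt0.
rewrite ge_max ler_pdivrMr ?divr_gt0// => /andP[lnq0 lnqC].
have etaq : eta <= q%:R^-1.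
  apply: le_trans etale _; rewrite lef_pV2 ?posrE ?powR_gt0//.
  rewrite -[leLHS]powRr1 ?ler0n// ler_powR ?ler1n//; lra.
pose X := c / (q%:R * eta).
have XE : X * eta = c / q%:R.
  by rewrite /X invfM mulrA -mulrA mulVf ?gt_eqF ?mulr1.
have X0 : 0 < X by rewrite divr_gt0 ?mulr_gt0.
have lnX : e * ln q%:R + ln c <= ln X.
  rewrite /X ln_div ?posrE ?mulr_gt0// lnM ?posrE//.
  suff : (1 + e) * ln q%:R <= - ln eta by lra.
  rewrite -ln_powR -lnV ?posrE// ler_ln ?posrE ?invr_gt0 ?powR_gt0//.
  by rewrite -[leLHS]invrK lef_pV2 ?posrE ?invr_gt0 ?powR_gt0.
have X8 : 8 <= X.
  rewrite -ler_ln ?posrE//; apply: le_trans lnX.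
  have : 0 <= e * ln q%:R by rewrite mulr_ge0// ltW.
  lra.
have /andP[bX Xb] := truncn_itv (ltW X0); rewrite -natr1 in Xb.
set b := Num.truncn X in bX Xb.
have b0 : (0 < b)%N by rewrite truncn_gt0; lra.
have Nb : (N0 <= b * q)%N by rewrite (leq_trans N0q)// leq_pmull.
have bqeta : b%:R * q%:R * eta <= c.
  by rewrite -mulrA -ler_pdivlMr ?mulr_gt0.
pose L := c / eta * (13 + ln q%:R).
have L0 : 0 < L by rewrite mulr_gt0 ?divr_gt0//; lra.
have [a [aa0 aa1 high]] := crossing_interval cpq q0 eta0 c0 c1 XE X8 bX Xb.
have notbad (l r : R) : 0 <= l -> r <= 1 -> c / 8 < r - l ->
    exists i v, [/\ (i < q)%N, l <= v < r &
      `|birkhoff_sum alpha (@recip R) (b * q) (i%:R / q%:R + v / q%:R) /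
          d (b * q)%N - 1| <= 4^-1].
  move=> l0 r1 ca.
  have lr : l <= r by lra.
  have mu : (lebesgue_measure [set x : R | ((x \in `[0, 1[) /\
      (4^-1 < `|birkhoff_sum alpha (@recip R) (b * q) x / d (b * q)%N - 1|))%R]
      < (r - l)%:E)%E.
    by apply: le_lt_trans (hN0 (b * q)%N Nb) _; rewrite lte_fin.
  have [i [v [iq av nbad]]] := exists_grid_point q0 l0 lr r1 mu.
  exists i, v; split => //; rewrite leNgt; apply/negP => h; apply: nbad.
  split => //=; rewrite in_itv/=; apply: grid_point_bounds => //.
  by case/andP: av => ? ?; apply/andP; split; lra.
have [i1 [v1 [iq1 hv1]]] : exists i v, [/\ (i < q)%N, 3 / 8 <= v < 5 / 8 &
      `|birkhoff_sum alpha (@recip R) (b * q) (i%:R / q%:R + v / q%:R) /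
          d (b * q)%N - 1| <= 4^-1] by apply: notbad; lra.
have low := birkhoff_sum_le_mid cpq q0 (le_trans bqeta c1) etaq iq1 hv1.
have [i2 [v2 [iq2 hv2]]] := notbad _ _ aa0 aa1 ltac:(lra).
have := high i2 v2 iq2 hv2.
set S2 := birkhoff_sum _ _ _ _ => high2.
set S1 := birkhoff_sum _ _ _ _ in low *.
have dp : 0 < d (b * q)%N by exact: d0.
move=> up dn; have := normalized_lt_double dp dn up.
have S1L : S1 <= L.
  apply: le_trans low _; rewrite /L ler_wpM2r//; first by lra.
  by rewrite ler_pdivlMr.
have S2L : 2 * L <= S2.
  apply: le_trans high2.
  have -> : 2 * L = eta^-1 * (2 * c * (13 + ln q%:R)) by rewrite /L; ring.
  rewrite ler_pM2l ?invr_gt0//.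
  rewrite ln_div ?posrE//.
  have ln48 : ln 4 <= ln 8 :> R by rewrite ler_ln ?posrE// ler_nat.
  have ce13 : c * (13 + ln q%:R) <= e / 4 * (13 + ln q%:R).
    by rewrite ler_wpM2r//; lra.
  by clear - ln48 ce13 lnX lnqC; lra.
by clear - S1L S2L; lra.
Qed.

End Dichotomy.

Theorem theorem5 (R : realType) (alpha : R) (alpha_gt0 : 0 < alpha)
    (alpha_lt1 : alpha < 1) (alpha_irr : irrational alpha) :
  ((exists d : nat -> R,
       (forall N : nat, 0 < d N) /\ weak_law alpha (@recip R) d)
     <-> roth_type alpha)
  /\ (roth_type alpha ->
      forall d : nat -> R,
        (forall N : nat, (2 <= N)%N -> d N = N%:R * ln (N%:R)) ->
        weak_law alpha (@recip R) d).
Proof.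
have law roth d dE :=
  @roth_weak_law R alpha d alpha_gt0 alpha_lt1 alpha_irr roth dE.
split=> //; split=> [[d [d0 wl]]|roth].
  exact: (weak_law_roth alpha_gt0 alpha_lt1 alpha_irr d0 wl).
exists (fun N => if (N < 2)%N then 1 else N%:R * ln N%:R); split => [N|].
  case: ltnP => // N2; rewrite mulr_gt0 ?ltr0n ?ln_gt0 ?ltr1n//.
  exact: leq_trans N2.
by apply: law => // N N2; rewrite ltnNge N2.
Qed.
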